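(* Let $a\in\mathbb{I}_1$. Then the map $a_{K[x]}$ is surjective iff $a=\sum_{i\ge n}a_{-i}\partial^i+a_F=a'\partial^n+a_F$ where $n\ge0$, $a_{-n}\neq0$, all $a_{-i}\in K[H]$, $a_F\in F$, $a':=\sum_{i\ge n}a_{-i}\partial^{i-n}$ (finite sums), and (1) if $a_F=0$ then none of the natural numbers $j\ge1$ is a root of the polynomial $a_{-n}\in K[H]$; in this case, $a'_{K[x]}$ is a bijection and $\ker(a_{K[x]})=\ker(\partial^n_{K[x]})=\bigoplus_{i=0}^{n-1}Kx^i$; and (2) if $a_F\ne0$ then none of the natural numbers $j\ge d+2$ (where $d=\deg_F(a)$) is a root of the polynomial $a_{-n}\in K[H]$ and $\mathrm{im}(a_{K[x]_{\le d}})+\sum_{j=0}^{\min\{d,n-1\}}K\,a'*x^{d-j}=K[x]_{\le d}$ (the sum over $j$ being zero if $n=0$); in this case there is a short exact sequence of finite dimensional vector spaces $$0\to\ker(a_{K[x]_{\le d}})\to\ker(a_{K[x]})\to\ker(\delta)\to0$$ where $\delta=a'\partial^n:\bigoplus_{i=d+1}^{d+n}Kx^i\to K[x]_{\le d}/aK[x]_{\le d}$, and therefore $\ker(a_{K[x]})=\ker(a_{K[x]_{\le d}})\oplus\bigoplus_{i=1}^sK(v_i-u_i)$ where $\{v_1,\ldots,v_s\}$ is a basis for the kernel of $\delta$ and $u_1,\ldots,u_s\in K[x]_{\le d}$ are any elements such that $a'\partial^n*v_i=a*u_i$. If the map $a_{K[x]}$ is surjective then $n=\mathrm{ind}_{K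[x]}(a)=\dim_K(\ker(a_{K[x]}))\ge0$.
   Context: $K$ is a field of characteristic zero. $\mathbb{I}_1$ is the subalgebra of $\mathrm{End}_K(K[x])$ generated by (multiplication by) $x$, $\partial=\frac{d}{dx}$ and $\int: x^n\mapsto \frac{x^{n+1}}{n+1}$. Put $H:=\partial x$ (so $H*x^n=(n+1)x^n$), $e_{ij}:=\int^i\partial^j-\int^{i+1}\partial^{j+1}$ ($i,j\ge0$) and $F:=\bigoplus_{i,j\ge0}Ke_{ij}$, an ideal of $\mathbb{I}_1$. Each $a\in\mathbb{I}_1$ is a unique finite sum $a=\sum_{i>0}a_{-i}\partial^i+a_0+\sum_{i>0}\int^ia_i+a_F$ with $a_k\in K[H]$ and $a_F=\sum\lambda_{ij}e_{ij}\in F$. If $a_F\neq 0$, $\deg_F(a):=\min\{n\ge0\mid a_F\in\bigoplus_{i,j=0}^nKe_{ij}\}$. $K[x]_{\le d}:=\bigoplus_{i=0}^dKx^i$. For $b\in\mathbb{I}_1$ and a $b$-invariant subspace $V$ of $K[x]$, $b_V:V\to V$, $v\mapsto b*v$, is the action of $b$ on $V$. $\mathrm{ind}_{K[x]}(a):=\dim_K\ker(a_{K[x]})-\dim_K\mathrm{coker}(a_{K[x]})$ for $a\in\mathbb{I}_1\setminus F$. *)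

(* Defs.v *)
From HB Require Import structures.
From mathcomp Require Import all_boot all_order all_algebra.
From mathcomp Require Import boolp classical_sets functions.

Set Implicit Arguments.
Unset Strict Implicit.
Unset Printing Implicit Defensive.

Import Order.TTheory GRing.Theory Num.Theory.

Local Open Scope classical_set_scope.
Local Open Scope ring_scope.

Section Operators.
Variable K : fieldType.
Implicit Types (f : {poly K}) (g : {poly K} -> {poly K}).

Definition mulX f : {poly K} := 'X * f.
Definition deltaX f : {poly K} := f^`().
Definition intX f : {poly K} :=
  \sum_(i < size f) (f`_i / i.+1%:R) *: 'X^(i.+1).

(* The subalgebra is generated inside all self-maps of K[x]; since the
   generators are linear, so is every element (see [I1_linear]). *)
Inductive I1 : ({poly K} -> {poly K}) -> Prop :=
| I1_mulX : I1 mulX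
| I1_deltaX : I1 deltaX
| I1_intX : I1 intX
| I1_one : I1 (fun f => f)
| I1_scale (k : K) g : I1 g -> I1 (fun f => k *: g f)
| I1_add g1 g2 : I1 g1 -> I1 g2 -> I1 (fun f => g1 f + g2 f)
| I1_comp g1 g2 : I1 g1 -> I1 g2 -> I1 (fun f => g1 (g2 f)).

Definition opH f : {poly K} := deltaX (mulX f).

(* An element of K[H] is encoded by p : {poly K} and acts on K[x] as p(H). *)
Definition polH (p f : {poly K}) : {poly K} :=
  \sum_(i < size p) p`_i *: iter i opH f.

Definition e_ (i j : nat) f : {poly K} :=
  iter i intX (iter j deltaX f) - iter i.+1 intX (iter j.+1 deltaX f).

Definition Fle (n : nat) : set ({poly K} -> {poly K}) :=
  [set g | exists lam : nat -> nat -> K, forall f,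
     g f = \sum_(i < n.+1) \sum_(j < n.+1) lam i j *: e_ i j f].

Definition idealF : set ({poly K} -> {poly K}) := \bigcup_n Fle n.

Definition is_degF g (d : nat) : Prop :=
  Fle d g /\ forall m, Fle m g -> (d <= m)%N.

(* Meaningful for g in F, see [degFP]. *)
Definition degF g : nat := xget 0%N [set d | is_degF g d].

(* [nonpos_form a n c aF] : a = \sum_(i >= n) a_{-i} \partial^i + a_F, where
   a_{-i} = c`_i and a_{-n} <> 0; the entries c`_i with i < n are irrelevant. *)
Definition nonpos_form (a : {poly K} -> {poly K}) (n : nat)
    (c : seq {poly K}) (aF : {poly K} -> {poly K}) : Prop :=
  [/\ c`_n != 0, idealF aF &
      forall f, a f = \sum_(n <= i < size c) polH c`_i (iter i deltaX f) + aF f].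

Definition aprime (n : nat) (c : seq {poly K}) f : {poly K} :=
  \sum_(n <= i < size c) polH c`_i (iter (i - n) deltaX f).

End Operators.

Section LinearAlgebra.
Variable K : fieldType.
Implicit Types (A B U W : set {poly K}) (g h : {poly K} -> {poly K}).

Definition ker g : set {poly K} := [set f | g f = 0].

Definition lspan s (v : 'I_s -> {poly K}) : set {poly K} :=
  [set f | exists k : 'I_s -> K, f = \sum_(i < s) k i *: v i].

Definition is_basis s (v : 'I_s -> {poly K}) U : Prop :=
  (forall k : 'I_s -> K, \sum_(i < s) k i *: v i = 0 -> forall i, k i = 0)
  /\ lspan v = U.

Definition has_dim U (m : nat) : Prop :=
  exists v : 'I_m -> {poly K}, is_basis v U.

Definition finite_dim U : Prop := exists m, has_dim U m.

(* The class f + W, as an element of a quotient by the subspace W. *)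
Definition coset W (f : {poly K}) : set {poly K} := [set f + w | w in W].

(* dim_K (K[x] / W) = m *)
Definition has_codim W (m : nat) : Prop :=
  exists v : 'I_m -> {poly K},
    (forall k : 'I_m -> K,
       coset W (\sum_(i < m) k i *: v i) = coset W 0 -> forall i, k i = 0)
    /\ (forall f, exists k : 'I_m -> K,
          coset W f = coset W (\sum_(i < m) k i *: v i)).

(* The index is only defined outside F. *)
Definition has_ind g (z : int) : Prop :=
  ~ idealF g /\
  exists p q : nat, [/\ has_dim (ker g) p, has_codim (range g) q &
                       z = p%:Z - q%:Z].

(* The direct sum of the lines K x^i for m <= i < n. *)
Definition monom_span (m n : nat) : set {poly K} :=
  [set f | exists k : nat -> K, f = \sum_(m <= i < n) k i *: 'X^i].

Definition sumset A B : set {poly K} := [set f + h | f in A & h in B].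

Definition is_dsum A B U : Prop :=
  sumset A B = U /\ A `&` B = [set 0].

(* The sum of the lines K (w i) is direct. *)
Definition direct_lines s (w : 'I_s -> {poly K}) : Prop :=
  forall k : 'I_s -> K,
    \sum_(i < s) k i *: w i = 0 -> forall i, k i *: w i = 0.

Definition linear_on A g : Prop :=
  forall (k : K) (f1 f2 : {poly K}), A f1 -> A f2 ->
    g (k *: f1 + f2) = k *: g f1 + g f2.

(* 0 -> A -g-> B -h-> U -> 0 is exact *)
Definition short_exact A B U g h : Prop :=
  [/\ linear_on A g, linear_on B h, set_inj A g,
      g @` A = B `&` ker h & h @` B = U].

(* The projection K[x] -> \bigoplus_(i > d) K x^i along K[x]_{<= d}. *)
Definition proj_gt (d : nat) (f : {poly K}) : {poly K} :=
  f - take_poly d.+1 f.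

End LinearAlgebra.

Section Sanity.
Variable K : fieldType.

Lemma intXE (f : {poly K}) :
  intX f = \poly_(i < (size f).+1) (f`_i.-1 / i%:R *+ (i != 0)%N).
Proof.
rewrite /intX poly_def big_ord_recl /= mulr0n scale0r add0r.
by apply: eq_bigr => i _; rewrite mulr1n.
Qed.

Lemma coef_intX (f : {poly K}) i :
  (intX f)`_i = f`_i.-1 / i%:R *+ (i != 0)%N.
Proof.
rewrite intXE coef_poly; case: ltnP => // hi.
case: i hi => [|i] //= hi; rewrite nth_default ?mul0r ?mul0rn //.
Qed.

Lemma intXn (n : nat) : intX ('X^n : {poly K}) = n.+1%:R^-1 *: 'X^(n.+1).
Proof.
apply/polyP => i; rewrite coef_intX coefZ !coefXn.
case: i => [|i] /=; first by rewrite mulr0n mulr0.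
rewrite eqSS mulr1n; case: eqP => [->|_]; first by rewrite mul1r mulr1.
by rewrite mul0r mulr0.
Qed.

Lemma opHXn (n : nat) : opH ('X^n : {poly K}) = n.+1%:R *: 'X^n.
Proof. by rewrite /opH /mulX /deltaX -exprS derivXn scaler_nat. Qed.

Lemma I1_linear (g : {poly K} -> {poly K}) : I1 g -> linear g.
Proof.
elim=> {g} [k u v|k u v|k u v|//|l g _ gl k u v|g1 g2 _ l1 _ l2 k u v
           |g1 g2 _ l1 _ l2 k u v].
- by rewrite /mulX mulrDr scalerAr.
- by rewrite /deltaX derivD derivZ.
- apply/polyP => i; rewrite coefD coefZ !coef_intX coefD coefZ.
  by rewrite mulrDl mulrnDl -mulrA mulrnAr.
- by rewrite gl scalerDr !scalerA mulrC.
- by rewrite l1 l2 scalerDr addrACA.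
- by rewrite l2 l1.
Qed.

Lemma nonpos_form_aprime (a : {poly K} -> {poly K}) n c aF :
  nonpos_form a n c aF ->
  forall f, a f = aprime n c (iter n (@deltaX K) f) + aF f.
Proof.
move=> [_ _ aE] f; rewrite aE /aprime; congr (_ + _).
rewrite big_nat [RHS]big_nat; apply: eq_bigr => i /andP[ni _].
by rewrite -iterD subnK.
Qed.

Lemma degFP (g : {poly K} -> {poly K}) : idealF g -> is_degF g (degF g).
Proof.
move=> [n _ Fn]; rewrite /degF.
have ex : exists m, `[< Fle m g >] by exists n; apply/asboolP.
case: (ex_minnP ex) => m /asboolP Fm mmin.
have gm : is_degF g m by split=> // k /asboolP; exact: mmin.
exact: (xgetI 0%N gm).
Qed.

End Sanity.

(* Main.v *)
Require Import Defs.
From HB Require Import structures.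
From mathcomp Require Import all_boot all_order all_algebra.
From mathcomp Require Import boolp classical_sets functions.
From mathcomp Require Import zify ring.
Set Implicit Arguments.
Unset Strict Implicit.
Unset Printing Implicit Defensive.
Import GRing.Theory.
Local Open Scope classical_set_scope.
Local Open Scope ring_scope.

(** In the basis of divided powers [x^k / k!], the operators [\partial] and
    [\int] are shifts and p(H) is diagonal. Every element [a] of the algebra
    therefore acts on [x^k / k!], for [k] large, through a band matrix with
    entries polynomial in [k], its symbol ([I1_has_symbol]); the operators that
    vanish on all high powers and have finite rank make up F.

    The top degree of the symbol decides whether [a] raises or lowers high
    degrees. If it is positive, or if the symbol is zero, a count of dimensions
    shows that [a] is not surjective ([raising_not_surjective],
    [finite_rank_not_surjective]). Otherwise it is [- n <= 0], and
    [a = a' \partial^n + a_F] ([surjective_nonpos_form]).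

    Let [D] be [0] if [a_F = 0] and [deg_F + 1] otherwise. Then [a_F] lives on
    polynomials of degree below [D], and from degree [D] on, [a] is triangular
    with the grading shifted by [n]; the diagonal entry that produces [x^k] from
    [x^(k+n)] is a nonzero multiple of [a_{-n}(k + 1)]. Such a map is surjective
    iff these entries do not vanish for [k >= D] and polynomials of degree below
    [D + n] are mapped onto those of degree below [D] ([surjective_criterion]).
    A zero entry would cost a dimension in the target, while almost all
    entries being nonzero reduces the count to finite dimension
    ([surjective_diag_neq0]). The condition on the block below [D] is the
    condition on [im(a)] in the theorem ([block_surj_sumset]).

    When [a] is surjective, its kernel lies in degree below [D + n], where [a]
    maps onto degree below [D]; hence its dimension is [n]
    ([surjective_dim_ker]). Projecting the kernel on degrees above [d] gives the
    exact sequence ([proj_gt_ker]). *)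

(** * Linear maps between truncations of K[x] *)

Section Truncations.
Variable K : fieldType.
Implicit Types (f g h : {poly K}) (T : {linear {poly K} -> {poly K}}).

Definition bundle_linear (g : {poly K} -> {poly K}) (glin : linear g) :
    {linear {poly K} -> {poly K}} :=
  HB.pack g (GRing.isLinear.Build K {poly K} {poly K} _ g glin).

Lemma size_sum_leq (I : Type) (r : seq I) (P : pred I) (F : I -> {poly K}) m :
  (forall i, P i -> (size (F i) <= m)%N) ->
  (size (\sum_(i <- r | P i) F i)%R <= m)%N.
Proof.
move=> Fm; apply: (big_ind (fun f => size f <= m)%N) => //.
  by rewrite size_poly0.
by move=> f g fm gm; rewrite (leq_trans (size_polyD _ _)) // geq_max fm.
Qed.

Lemma linear_coef_expansion T s f : (size f <= s)%N ->
  T f = \sum_(i < s) f`_i *: T 'X^i.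
Proof.
move=> fs; have -> : f = \sum_(i < s) f`_i *: 'X^i.
  by rewrite -poly_def; apply/polyP=> j; rewrite coef_poly; case: ltnP => // sj;
     rewrite nth_default ?(leq_trans fs).
rewrite linear_sum; apply: eq_bigr => i _; rewrite linearZ /= -poly_def.
by rewrite coef_poly ltn_ord.
Qed.

Lemma linear_top_coef T p s f : (size f <= p.+1)%N ->
  (forall g, (size g <= p)%N -> (T g)`_s = 0) ->
  (T f)`_s = f`_p * (T 'X^p)`_s.
Proof.
move=> fs Tp.
have -> : T f = T (take_poly p f) + f`_p *: T 'X^p.
  rewrite -linearZ -linearD; congr (T _); apply/polyP=> j.
  rewrite coefD coefZ coefXn coef_take_poly; case: ltngtP => [jp|pj|->].
  - by rewrite mulr0 addr0.
  - by rewrite [LHS]nth_default ?(leq_trans fs) // mulr0 addr0.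
  - by rewrite mulr1 add0r.
by rewrite coefD coefZ Tp ?add0r // size_take_poly.
Qed.

Lemma monom_spanE m n : monom_span m n =
  [set f : {poly K} | (size f <= n)%N /\ forall j, (j < m)%N -> f`_j = 0].
Proof.
apply/seteqP; split=> f /=.
  move=> [k ->]; split.
    rewrite big_nat; apply: size_sum_leq => i /andP[_ ni].
    by rewrite (leq_trans (size_scale_leq _ _)) // size_polyXn.
  move=> j jm; rewrite coef_sum big_nat big1 // => i /andP[mi _].
  by rewrite coefZ coefXn; case: eqP => [?|_]; [lia|rewrite mulr0].
move=> [fn fm]; exists (fun i => f`_i); apply/polyP=> j.
rewrite coef_sum; under eq_bigr => i _ do rewrite coefZ coefXn.
have [jm|mj] := ltnP j m.
  rewrite fm // big_nat big1 // => i /andP[mi _].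
  by case: eqP => [?|_]; [lia|rewrite mulr0].
have [nj|jn] := leqP n j.
  rewrite nth_default ?(leq_trans fn) // big_nat big1 // => i /andP[_ ni].
  by case: eqP => [?|_]; [lia|rewrite mulr0].
rewrite (bigD1_seq j) ?mem_index_iota ?iota_uniq ?mj //= eqxx mulr1.
rewrite big1 ?addr0 // => i ij.
by rewrite eq_sym (negPf ij) mulr0.
Qed.

Definition truncation_mx T s r : 'M[K]_(s, r) :=
  lin1_mx (poly_rV \o T \o rVpoly).

Lemma mul_truncation_mx T s r (u : 'rV_s) :
  u *m truncation_mx T s r = poly_rV (T (rVpoly u)).
Proof. by rewrite mul_rV_lin1. Qed.

Lemma truncation_mx_rank T s r :
  (forall h, (size h <= r)%N -> exists2 f : {poly K}, (size f <= s)%N & T f = h) ->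
  \rank (truncation_mx T s r) = r.
Proof.
move=> Tsurj; apply/eqP/row_fullP.
have /choice[F FE] : forall i : 'I_r, exists f : {poly K},
    (size f <= s)%N /\ T f = 'X^i.
  move=> i; have [|f fs Tf] := Tsurj 'X^i; first by rewrite size_polyXn ltn_ord.
  by exists f.
exists (\matrix_i poly_rV (F i)).
apply/row_matrixP=> i; have [Fs TF] := FE i.
rewrite row_mul rowK mul_truncation_mx poly_rV_K // TF row1.
by apply/rowP=> j; rewrite !mxE coefXn.
Qed.

Lemma surjective_truncation_leq T s r :
  (forall h, (size h <= r)%N -> exists2 f : {poly K}, (size f <= s)%N & T f = h) ->
  (r <= s)%N.
Proof. by move/truncation_mx_rank => <-; exact: rank_leq_row. Qed.

(** Splitting [f] as [f0 + x^s0 f1], the part [f0] contributes at most [r0]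
    dimensions and [f1] at most [s - s0]. To read this off the case of a single
    truncation, the map [T] is replaced by [f |-> f0' + T (x^s0 f1)], where
    [f = f0' + x^r0 f1], defined on polynomials of degree below
    [r0 + (s - s0)].  *)
Lemma surjective_truncation_block T s r s0 r0 : (s0 <= s)%N ->
  (forall h, (size h <= r)%N -> exists2 f : {poly K}, (size f <= s)%N & T f = h) ->
  (forall f, (size f <= s0)%N -> (size (T f) <= r0)%N) ->
  (r <= r0 + (s - s0))%N.
Proof.
move=> s0s Tsurj Tr0.
pose S f := take_poly r0 f + T (drop_poly r0 f * 'X^s0).
have linS : linear S.
  move=> k f g; rewrite /S !linearP /= mulrDl -scalerAl linearP /=.
  by rewrite scalerDr addrACA.
pose S' := bundle_linear linS.
apply: (@surjective_truncation_leq S') => h /Tsurj[f fs Tf].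
exists (T (take_poly s0 f) + drop_poly s0 f * 'X^r0).
  apply/leq_sizeP => j hj; rewrite coefD coefMXn coef_drop_poly.
  rewrite nth_default ?add0r; last first.
    by apply: leq_trans (Tr0 _ (size_take_poly _ _)) _; lia.
  by case: ltnP => // r0j; rewrite nth_default ?(leq_trans fs) //; lia.
have Ts0 := Tr0 _ (size_take_poly s0 f).
rewrite /= /S -Tf.
have -> : T f = T (take_poly s0 f) + T (drop_poly s0 f * 'X^s0).
  by rewrite -linearD poly_take_drop.
congr (_ + T (_ * _)).
  apply/polyP=> j; rewrite coef_take_poly coefD coefMXn; case: ltnP => jr.
    by rewrite addr0.
  by rewrite nth_default ?(leq_trans Ts0).
apply/polyP=> j; rewrite !coef_drop_poly coefD coefMXn.
rewrite nth_default ?add0r ?(leq_trans Ts0) ?leq_addl //.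
by rewrite ltnNge leq_addl /= addnK coef_drop_poly.
Qed.

Lemma has_dim_rowspace m s (A : 'M[K]_(m, s)) :
  has_dim [set f : {poly K} | exists2 u : 'rV_s, (u <= A)%MS & f = rVpoly u] (\rank A).
Proof.
exists (fun i => rVpoly (row i (row_base A))).
have vE (k : 'I_(\rank A) -> K) : \sum_i k i *: rVpoly (row i (row_base A)) =
    rVpoly ((\row_i k i) *m row_base A).
  rewrite mulmx_sum_row linear_sum; apply: eq_bigr => i _.
  by rewrite linearZ /= mxE.
split=> [k|].
  rewrite vE => /(congr1 (@poly_rV K s)); rewrite rVpolyK linear0.
  rewrite -(mul0mx _ (row_base A)) => /(row_free_inj (row_base_free A)).
  by move=> /rowP k0 i; have := k0 i; rewrite !mxE.
apply/seteqP; split=> f /=.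
  move=> [k ->]; rewrite vE; eexists; last by [].
  by rewrite -(eq_row_base A) submxMl.
move=> [u]; rewrite -(eq_row_base A) => /submxP[D ->] ->.
exists (fun i => D 0 i); rewrite vE; congr (rVpoly (_ *m _)).
by apply/rowP=> i; rewrite !mxE.
Qed.

(** The bound [r] on the image guarantees that the matrix, which forgets the
    coefficients of [T f] from degree [r] on, has the same kernel as [T].  *)
Lemma has_dim_truncated_ker T s r :
  (forall f, (size f <= s)%N -> (size (T f) <= r)%N) ->
  has_dim [set f : {poly K} | (size f <= s)%N /\ T f = 0]
          (s - \rank (truncation_mx T s r)).
Proof.
move=> Tsr; rewrite -mxrank_ker.
have -> : [set f : {poly K} | (size f <= s)%N /\ T f = 0] =
  [set f : {poly K} | exists2 u : 'rV_s, (u <= kermx (truncation_mx T s r))%MS &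
     f = rVpoly u].
  apply/seteqP; split=> f /=.
    move=> [fs Tf]; exists (poly_rV f); last by rewrite poly_rV_K.
    by apply/sub_kermxP; rewrite mul_truncation_mx poly_rV_K // Tf linear0.
  move=> [u /sub_kermxP]; rewrite mul_truncation_mx => Tu ->.
  have us : (size (rVpoly u) <= s)%N by rewrite size_poly.
  by split=> //; rewrite -(poly_rV_K (Tsr _ us)) Tu linear0.
exact: has_dim_rowspace.
Qed.

Lemma finite_dim_lspan s (v : 'I_s -> {poly K}) : finite_dim (lspan v).
Proof.
pose N := \max_i size (v i).
pose A := \matrix_i poly_rV (v i) : 'M[K]_(s, N).
exists (\rank A).
suff -> : lspan v = [set f : {poly K} | exists2 u : 'rV_N, (u <= A)%MS & f = rVpoly u].
  exact: has_dim_rowspace.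
have vE (k : 'I_s -> K) : \sum_i k i *: v i = rVpoly ((\row_i k i) *m A).
  rewrite mulmx_sum_row linear_sum; apply: eq_bigr => i _.
  by rewrite linearZ /= mxE rowK poly_rV_K // (leq_bigmax i).
apply/seteqP; split=> f /=.
  by move=> [k ->]; rewrite vE; eexists; last by []; exact: submxMl.
move=> [u /submxP[D ->] ->]; exists (fun i => D 0 i); rewrite vE.
by congr (rVpoly (_ *m _)); apply/rowP=> i; rewrite !mxE.
Qed.

Lemma finite_dim_image T U : finite_dim U -> finite_dim (T @` U).
Proof.
move=> [m [v [_ <-]]].
suff -> : T @` lspan v = lspan (T \o v) by exact: finite_dim_lspan.
have Tk (k : 'I_m -> K) : T (\sum_i k i *: v i) = \sum_i k i *: (T \o v) i.
  by rewrite linear_sum; apply: eq_bigr => i _; rewrite linearZ.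
apply/seteqP; split=> f /=.
  by move=> [g [k ->] <-]; exists k; rewrite Tk.
by move=> [k ->]; rewrite -Tk; eexists; [exists k|].
Qed.

End Truncations.

(** * Linear maps that lower the degree by n *)

Section LoweringMaps.
Variables (K : fieldType) (T : {linear {poly K} -> {poly K}}) (n : nat).
Implicit Types (f g h : {poly K}).

(** From degree [D] on, [T] is triangular with respect to the monomials, with
    the grading shifted by [n]; [diag_neq0] concerns its diagonal entries and
    [block_surj] what happens below the threshold [D].  *)
Definition lowers (D : nat) : Prop :=
  forall k f, (D <= k)%N -> (size f <= k + n)%N -> (size (T f) <= k)%N.

Definition diag_neq0 (D : nat) : Prop :=
  forall k, (D <= k)%N -> (T 'X^(k + n))`_k != 0.

Definition block_surj (D : nat) : Prop :=
  forall h, (size h <= D)%N -> exists2 f : {poly K}, (size f <= D + n)%N & T f = h.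

Lemma lowers_coef D k f : lowers D -> (D <= k)%N -> (size f <= (k + n).+1)%N ->
  (T f)`_k = f`_(k + n) * (T 'X^(k + n))`_k.
Proof.
move=> Tlow Dk fs; apply: linear_top_coef => // g gs.
by rewrite nth_default // Tlow.
Qed.

(** With nonzero diagonal entries above [N], no leading term of degree at least
    [N + n] can cancel in [T f].  *)
Lemma lowers_preimage D N f : lowers D -> diag_neq0 N -> (D <= N)%N ->
  (size (T f) <= N)%N -> (size f <= N + n)%N.
Proof.
move=> Tlow Tdiag DN TfN; rewrite leqNgt; apply/negP => fN.
have [k fk] : exists k, size f = (k + n).+1.
  by exists (size f - n).-1; lia.
have Nk : (N <= k)%N by lia.
have /eqP := lowers_coef Tlow (leq_trans DN Nk) (eq_leq fk).
rewrite nth_default ?(leq_trans TfN) // eq_sym mulf_eq0 (negPf (Tdiag _ Nk)).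
have -> : (k + n)%N = (size f).-1 by rewrite fk.
rewrite orbF -/(lead_coef f) lead_coef_eq0 => /eqP f0.
by rewrite f0 size_poly0 in fk.
Qed.

Lemma surjective_block D : lowers D -> diag_neq0 D ->
  (forall h, exists f, T f = h) -> block_surj D.
Proof.
move=> Tlow Tdiag Tsurj h hD; have [f Tf] := Tsurj h; exists f => //.
by apply: (lowers_preimage Tlow Tdiag); rewrite ?Tf.
Qed.

(** A single vanishing entry [k] loses one dimension that nothing can recover:
    polynomials of degree at most [k + n] are then sent to degree below [k].
    Counting dimensions requires finite dimensional spaces, and these come from
    the entries above [N], which confine preimages to bounded degree.  *)
Lemma surjective_diag_neq0 D N : lowers D -> diag_neq0 N ->
  (forall h, exists f, T f = h) -> diag_neq0 D.
Proof.
move=> Tlow TdiagN Tsurj k Dk; have [Nk|kN] := leqP N k; first exact: TdiagN.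
apply/eqP => Tk0.
have TlowN : lowers N by move=> j f Nj; apply: Tlow; lia.
have := @surjective_truncation_block _ T (N + n) N (k.+1 + n) k.
move/(_ ltac:(lia) (surjective_block TlowN TdiagN Tsurj)) => /= H.
suff /H : forall f, (size f <= k.+1 + n)%N -> (size (T f) <= k)%N by lia.
move=> f fk; apply/leq_sizeP => j; rewrite leq_eqVlt => /predU1P[<-|kj].
  by rewrite (lowers_coef Tlow) // Tk0 mulr0.
by rewrite nth_default // (leq_trans _ kj) // Tlow // leqW.
Qed.

(** The nonzero diagonal entries above [D] allow the leading term of the target
    to be removed, until its degree falls below [D].  *)
Lemma block_surjective D : lowers D -> diag_neq0 D -> block_surj D ->
  forall h, exists f, T f = h.
Proof.
move=> Tlow Tdiag Tblock h; have [m] := ubnP (size h).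
elim: m h => // m IHm h; rewrite ltnS leq_eqVlt => /predU1P[hm|]; last exact: IHm.
have [/Tblock[f _ <-]|Dh] := leqP (size h) D; first by exists f.
case: m hm IHm => [|k] hk IHk; first by lia.
have Dk : (D <= k)%N by lia.
(* The multiple of x^(k + n) whose image has the leading term of h. *)
pose c := h`_k / (T 'X^(k + n))`_k.
have [|f Tf] := IHk (h - T (c *: 'X^(k + n))).
  rewrite ltnS; apply/leq_sizeP => j; rewrite coefB linearZ coefZ /=.
  rewrite leq_eqVlt => /predU1P[<-|kj].
    by rewrite divfK ?subrr // Tdiag.
  rewrite !nth_default ?mulr0 ?subrr ?hk //.
  by apply: leq_trans kj; rewrite Tlow ?size_polyXn // leqW.
by exists (f + c *: 'X^(k + n)); rewrite linearD Tf subrK.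
Qed.

Lemma has_dim_ker_lowering D : lowers D -> diag_neq0 D -> block_surj D ->
  has_dim (ker T) n.
Proof.
move=> Tlow Tdiag Tblock.
have -> : ker T = [set f : {poly K} | (size f <= D + n)%N /\ T f = 0].
  apply/seteqP; split=> f /=; last by case.
  move=> Tf; split=> //; apply: (lowers_preimage Tlow Tdiag) => //.
  by rewrite Tf size_poly0.
have := has_dim_truncated_ker (fun f => Tlow D f (leqnn D)).
by rewrite truncation_mx_rank // addKn.
Qed.

End LoweringMaps.

(** * Divided power coordinates *)

Section DividedPowers.
Variables (K : fieldType) (charK0 : [pchar K] =i pred0).
Implicit Types (f g h : {poly K}).

Lemma natr_neq0 m : (m.+1%:R : K) != 0.
Proof. by rewrite (pcharf0P _).1. Qed.

Lemma natr_inj m k : m%:R = k%:R :> K -> m = k.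
Proof.
wlog mk : m k / (m <= k)%N => [H E|].
  by case/orP: (leq_total m k) => mk; [exact: H|apply/esym/H].
move/eqP; rewrite eq_sym -subr_eq0 -natrB // (pcharf0P _).1 //; lia.
Qed.

Lemma fact_neq0 m : (m`!%:R : K) != 0.
Proof. by rewrite (pcharf0P _).1 // -lt0n fact_gt0. Qed.

(** Characteristic zero enters here: distinct natural numbers stay distinct
    in [K], so only finitely many of them are roots.  *)
Lemma eventually_nonroot (p : {poly K}) : p != 0 ->
  exists N, forall k, (N <= k)%N -> p.[k%:R] != 0.
Proof.
have [m] := ubnP (size p); elim: m p => // m IHm p pm p0.
have [[k0 /factor_theorem[q pE]]|nr] :=
    pselect (exists k0 : nat, root p k0%:R); last first.
  by exists 0%N => k _; apply/negP => rk; apply: nr; exists k.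
have q0 : q != 0 by apply: contraNneq p0 => q0; rewrite pE q0 mul0r.
have [|//|N qN] := IHm q.
  by move: pm; rewrite pE size_Mmonic ?monicXsubC // size_XsubC addn2.
exists (maxn N k0.+1) => k; rewrite geq_max => /andP[Nk k0k].
rewrite pE hornerM hornerXsubC mulf_neq0 ?qN // subr_eq0.
by apply: contraTneq k0k => /natr_inj ->; rewrite ltnn.
Qed.

(** The coordinate of [f] on the divided power [x^j / j!]. In the basis of
    divided powers, differentiation and integration are shifts, and p(H) is
    diagonal with entries [p.[j + 1]].  *)
Definition ncoef f j : K := f`_j * j`!%:R.

Definition dpow k : {poly K} := k`!%:R^-1 *: 'X^k.

Lemma ncoef_eq0 f j : (ncoef f j == 0) = (f`_j == 0).
Proof. by rewrite mulf_eq0 (negPf (fact_neq0 j)) orbF. Qed.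

Lemma ncoef_inj f g : (forall j, ncoef f j = ncoef g j) -> f = g.
Proof. by move=> fg; apply/polyP=> j; apply/(mulIf (fact_neq0 j))/fg. Qed.

Lemma ncoef0 j : ncoef 0 j = 0.
Proof. by rewrite /ncoef coef0 mul0r. Qed.

Lemma ncoefD f g j : ncoef (f + g) j = ncoef f j + ncoef g j.
Proof. by rewrite /ncoef coefD mulrDl. Qed.

Lemma ncoefB f g j : ncoef (f - g) j = ncoef f j - ncoef g j.
Proof. by rewrite /ncoef coefB mulrBl. Qed.

Lemma ncoefZ k f j : ncoef (k *: f) j = k * ncoef f j.
Proof. by rewrite /ncoef coefZ mulrA. Qed.

Lemma ncoef_sum (I : Type) (r : seq I) (P : pred I) F j :
  ncoef (\sum_(i <- r | P i) F i) j = \sum_(i <- r | P i) ncoef (F i) j.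
Proof. by rewrite /ncoef coef_sum mulr_suml. Qed.

Lemma ncoef_dpow k j : ncoef (dpow k) j = (j == k)%:R.
Proof.
rewrite /ncoef coefZ coefXn; case: eqP => [->|_]; last by rewrite mulr0 mul0r.
by rewrite mulr1 mulVf ?fact_neq0.
Qed.

Lemma dpowE k : 'X^k = k`!%:R *: dpow k.
Proof. by rewrite scalerA divff ?scale1r ?fact_neq0. Qed.

Lemma ncoef_deltaX f j : ncoef (deltaX f) j = ncoef f j.+1.
Proof. by rewrite /ncoef coef_deriv factS natrM -(mulr_natr f`_j.+1) mulrA. Qed.

Lemma ncoef_iter_deltaX i f j : ncoef (iter i (@deltaX K) f) j = ncoef f (i + j).
Proof. by elim: i j => // i IHi j; rewrite iterS ncoef_deltaX IHi addnS. Qed.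

Lemma ncoef_mulX f j : ncoef (mulX f) j = j%:R * ncoef f j.-1.
Proof.
rewrite /ncoef coefXM; case: j => [|j] /=; first by rewrite !mul0r.
by rewrite factS natrM mulrCA.
Qed.

Lemma ncoef_intX f j : ncoef (intX f) j = if j is j'.+1 then ncoef f j' else 0.
Proof.
rewrite /ncoef coef_intX; case: j => [|j] /=; first by rewrite mulr0n mul0r.
by rewrite mulr1n factS natrM mulrA divfK ?natr_neq0.
Qed.

Lemma ncoef_iter_intX i f j :
  ncoef (iter i (@intX K) f) j = if (j < i)%N then 0 else ncoef f (j - i).
Proof.
elim: i j => [|i IHi] j; first by rewrite subn0.
by rewrite iterS ncoef_intX; case: j => // j; rewrite IHi ltnS.
Qed.

Lemma ncoef_polH p f j : ncoef (polH p f) j = p.[j.+1%:R] * ncoef f j.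
Proof.
rewrite /polH ncoef_sum horner_coef mulr_suml; apply: eq_bigr => i _.
rewrite ncoefZ -mulrA; congr (_ * _); elim: (nat_of_ord i) => [|k IHk].
  by rewrite mul1r.
by rewrite iterS exprS /opH ncoef_deltaX ncoef_mulX IHk mulrA.
Qed.

(** The two terms of [e_ i j] are the same shift, except that the second also
    kills [x^j]: hence [e_ i j] is a matrix unit in divided powers.  *)
Lemma e_E i j f : e_ i j f = (ncoef f j / i`!%:R) *: 'X^i.
Proof.
apply: ncoef_inj => k; rewrite /e_ ncoefB !ncoef_iter_intX !ncoef_iter_deltaX.
rewrite dpowE 2!ncoefZ ncoef_dpow mulrA divfK ?fact_neq0 //.
case: ltngtP => [ki|ik|->] /=.
- by rewrite ltnS (ltnW ki) subrr mulr0.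
- by rewrite ltnS leqNgt ik /= addSn -addnS -subSn // subSS subrr mulr0.
- by rewrite ltnSn subr0 subnn addn0 mulr1.
Qed.

End DividedPowers.

(** * Symbols of the elements of the algebra *)

Section Symbols.
Variables (K : fieldType) (charK0 : [pchar K] =i pred0).
Implicit Types (f g h : {poly K}) (u v : nat -> {poly K}) (q : {poly {poly K}}).

(** The values [u k] of an operator on the divided powers [x^k / k!], for
    [k >= N], given by a band matrix with entries polynomial in [k]. The symbol
    [q] is a Laurent polynomial in the shift with coefficients in [K[k]],
    multiplied by the power [m] of the shift to clear denominators: the
    coefficient [q`_e] belongs to degree [e - m]. The condition [m <= N] makes
    the degrees [k + e - m] true subtractions. Nothing is
    required of small [k], so that operators in F have symbol zero.  *)
Definition symbol_of u m q N : Prop := (m <= N)%N /\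
  forall k j, (N <= k)%N ->
    ncoef (u k) j = if (k <= j + m)%N then (q`_(j + m - k)).[k%:R] else 0.

Definition has_symbol u : Prop := exists m q N, symbol_of u m q N.

Lemma has_symbol_eventually u v N :
  (forall k, (N <= k)%N -> u k = v k) -> has_symbol u -> has_symbol v.
Proof.
move=> uv [m [q [M [mM uE]]]]; exists m, q, (maxn N M); split.
  by rewrite leq_max mM orbT.
by move=> k j; rewrite geq_max => /andP[Nk Mk]; rewrite -uv // uE.
Qed.

Lemma has_symbol_dpow : has_symbol (@dpow K).
Proof.
exists 0%N, 1, 0%N; split=> // k j _; rewrite ncoef_dpow // addn0 coef1.
rewrite subn_eq0; case: ltngtP => [||->] //=; rewrite ?hornerC //.
Qed.

Lemma symbol_of_raise u m q N l :
  symbol_of u m q N -> symbol_of u (m + l) (q * 'X^l) (N + l).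
Proof.
move=> [mN uE]; split=> [|k j Nk]; first by rewrite leq_add2r.
rewrite uE ?coefMXn; last by lia.
have -> : (j + (m + l) - k - l = j + m - k)%N by lia.
case: (leqP k (j + m)) => k1; first by rewrite ifT ?ifF //; lia.
by case: ifP => // k2; rewrite ifT ?horner0 //; lia.
Qed.

Lemma has_symbol_add u v :
  has_symbol u -> has_symbol v -> has_symbol (fun k => u k + v k).
Proof.
move=> [m1 [q1 [N1 su]]] [m2 [q2 [N2 sv]]].
have [mN1 uE] := symbol_of_raise m2 su; have [mN2 vE] := symbol_of_raise m1 sv.
exists (m1 + m2)%N, (q1 * 'X^m2 + q2 * 'X^m1), (N1 + m2 + (N2 + m1))%N.
split=> [|k j Nk]; first by lia.
rewrite ncoefD uE ?vE ?coefD ?hornerD; [|lia|lia].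
by rewrite [(m2 + m1)%N]addnC; case: ifP => _ //; rewrite addr0.
Qed.

Lemma has_symbol_scale u (p : {poly K}) :
  has_symbol u -> has_symbol (fun k => p.[k%:R] *: u k).
Proof.
move=> [m [q [N [mN uE]]]]; exists m, (p *: q), N; split=> // k j Nk.
by rewrite ncoefZ uE // coefZ hornerM; case: ifP => _ //; rewrite mulr0.
Qed.

(** Replacing [k] by [k + e - l] translates the argument of the coefficients
    of the symbol. This is what the composition of two operators needs.  *)
Lemma has_symbol_shift u e l : has_symbol u -> has_symbol (fun k => u (k + e - l)%N).
Proof.
move=> [m [q [N [mN uE]]]].
pose sh (p : {poly K}) := p \Po ('X + (e%:R - l%:R)%:P).
(* The shift by - l goes into the denominator, the one by e into the symbol. *)
exists (m + l)%N, (map_poly sh q * 'X^e), (N + l)%N; split; first by lia.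
move=> k j Nk; rewrite uE; last by lia.
rewrite coefMXn.
have sh0 : sh 0 = 0 by rewrite /sh linear0.
case: (leqP (k + e - l) (j + m)) => k1; case: (leqP k (j + (m + l))) => k2 //.
- case: ifP => k3; first by lia.
  have -> : (j + (m + l) - k - e = j + m - (k + e - l))%N by lia.
  rewrite coef_map_id0 // horner_comp hornerD hornerX hornerC natrB ?natrD.
    by rewrite addrA.
  by lia.
- by lia.
- by case: ifP => k3; rewrite ?horner0 //; lia.
Qed.

Lemma has_symbol_sum (n : nat) (u : 'I_n -> nat -> {poly K}) :
  (forall i, has_symbol (u i)) -> has_symbol (fun k => \sum_i u i k).
Proof.
elim: n u => [|n IHn] u us.
  exists 0%N, 0, 0%N; split=> // k j _.
  by rewrite big_ord0 ncoef0 coef0 horner0 if_same.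
apply: (@has_symbol_eventually (fun k => u ord0 k + \sum_i u (lift ord0 i) k) _ 0%N).
  by move=> k _; rewrite big_ord_recl.
by apply: has_symbol_add => //; apply: IHn.
Qed.

Lemma symbol_expansion u m q N k : symbol_of u m q N -> (N <= k)%N ->
  u k = \sum_(e < size q) (q`_e).[k%:R] *: dpow K (k + e - m).
Proof.
move=> [mN uE] Nk; apply: (ncoef_inj charK0) => j; rewrite uE // ncoef_sum.
under eq_bigr => e _ do rewrite ncoefZ ncoef_dpow //.
case: leqP => kj; last first.
  rewrite big1 // => e _; case: eqP => [jE|_]; last by rewrite mulr0.
  by lia.
have [qs|qs] := ltnP (j + m - k) (size q).
  rewrite (bigD1 (Ordinal qs)) //= big1 => [|e].
    by rewrite addr0 (_ : (j == _) = true) ?mulr1 //; apply/eqP; lia.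
  rewrite -val_eqE /= => ne; case: eqP => [jE|_]; last by rewrite mulr0.
  by move/eqP: ne; lia.
rewrite nth_default // horner0 big1 // => e _.
case: eqP => [jE|_]; last by rewrite mulr0.
by have := ltn_ord e; lia.
Qed.

(** For a composite [g1 \o g2], expanding [g2 (x^k / k!)] on divided powers
    writes the values of the composite as a sum of shifts of the values
    of [g1], multiplied by polynomials in [k].  *)
Lemma I1_has_symbol (g : {poly K} -> {poly K}) : I1 g -> has_symbol (fun k => g (dpow K k)).
Proof.
elim=> {g} [||||c g _ gs|g1 g2 _ s1 _ s2|g1 g2 I1g1 s1 _ [m [q [N s2]]]].
- apply: (@has_symbol_eventually
    (fun k => ('X + 1%:P).[k%:R] *: dpow K (k + 1 - 0)) _ 0%N).
    move=> k _; apply: (ncoef_inj charK0) => j.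
    rewrite ncoefZ ncoef_mulX !ncoef_dpow // !hornerE addn1 subn0.
    case: j => [|j] /=; first by rewrite mul0r mulr0.
    by rewrite eqSS; case: eqP => [->|_]; rewrite ?mulr0 // -natr1.
  exact/has_symbol_scale/has_symbol_shift/has_symbol_dpow.
- apply: (@has_symbol_eventually (fun k => dpow K (k + 0 - 1)) _ 1%N).
    move=> [//|k] _; apply: (ncoef_inj charK0) => j.
    by rewrite ncoef_deltaX !ncoef_dpow // addn0 subn1 eqSS.
  exact/has_symbol_shift/has_symbol_dpow.
- apply: (@has_symbol_eventually (fun k => dpow K (k + 1 - 0)) _ 0%N).
    move=> k _; apply: (ncoef_inj charK0) => j.
    rewrite ncoef_intX // ncoef_dpow // subn0 addn1.
    by case: j => [|j]; rewrite ?eqSS // ncoef_dpow.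
  exact/has_symbol_shift/has_symbol_dpow.
- exact: has_symbol_dpow.
- apply: (@has_symbol_eventually (fun k => c%:P.[k%:R] *: g (dpow K k)) _ 0%N).
    by move=> k _; rewrite hornerC.
  exact: has_symbol_scale.
- exact: has_symbol_add.
- pose g1' := bundle_linear (I1_linear I1g1).
  apply: (@has_symbol_eventually (fun k => \sum_(e < size q)
    (q`_e).[k%:R] *: g1 (dpow K (k + e - m))) _ N).
    move=> k Nk; rewrite (symbol_expansion s2 Nk) -[RHS]/(g1' _) linear_sum.
    by apply: eq_bigr => e _; rewrite linearZ.
  apply: has_symbol_sum => e; apply: has_symbol_scale.
  exact: (has_symbol_shift e m s1).
Qed.

End Symbols.

(** * The ideal F and the nonpositive part *)

Section FiniteRank.
Variables (K : fieldType) (charK0 : [pchar K] =i pred0).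
Implicit Types (f : {poly K}) (g : {poly K} -> {poly K}).

(** [g] only sees the coefficients of degree below [D] and takes values in
    degree below [D]. Elements of F of degree [d] are in block [d + 1], and the
    zero operator is in block [0]: this makes the cases [a_F = 0] and
    [a_F <> 0] instances of one criterion.  *)
Definition in_block D g : Prop :=
  (forall f, (size (g f) <= D)%N) /\
  (forall f, (forall j, (j < D)%N -> f`_j = 0) -> g f = 0).

Lemma Fle_in_block d g : Fle d g -> in_block d.+1 g.
Proof.
move=> [lam gE]; split=> [f|f f0]; rewrite gE.
  apply: size_sum_leq => i _; apply: size_sum_leq => j _.
  rewrite e_E // (leq_trans (size_scale_leq _ _)) //.
  by rewrite (leq_trans (size_scale_leq _ _)) // size_polyXn.
rewrite big1 // => i _; rewrite big1 // => j _.
by rewrite e_E // /ncoef f0 ?ltn_ord // !mul0r scale0r scaler0.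
Qed.

(** The coefficients on the matrix units [e_ i j] are the matrix entries of [T],
    rescaled from monomials to divided powers.  *)
Lemma idealF_finite_rank (T : {linear {poly K} -> {poly K}}) N :
  (forall k, (N <= k)%N -> T 'X^k = 0) -> idealF T.
Proof.
move=> TN; pose d := maxn N (\max_(k < N) size (T 'X^k)); exists d => //.
have Td (j k : nat) : (d < k)%N -> (T 'X^j)`_k = 0.
  move=> dk; have [/TN->|jN] := leqP N j; first by rewrite coef0.
  rewrite nth_default // (leq_trans _ (ltnW dk)) // leq_max.
  by apply/orP; right; apply: (leq_bigmax (Ordinal jN)).
exists (fun i j => i`!%:R / j`!%:R * (T 'X^j)`_i) => f.
rewrite (@linear_coef_expansion _ _ (d.+1 + size f)) ?leq_addl //.
rewrite big_split_ord /= [X in _ + X]big1 ?addr0; last first.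
  by move=> i _; rewrite TN ?scaler0 // /d; lia.
rewrite exchange_big /=; apply: eq_bigr => j _.
apply/polyP=> k; rewrite coefZ coef_sum.
have eE (i : 'I_d.+1) : (i`!%:R / j`!%:R * (T 'X^j)`_i *: e_ i j f)`_k =
    f`_j * (T 'X^j)`_i * (k == i)%:R.
  rewrite e_E // /ncoef !coefZ coefXn; case: (k == i); last by rewrite !mulr0.
  by field; rewrite !fact_neq0.
under eq_bigr => i _ do rewrite eE.
have [kd|dk] := ltnP k d.+1.
  rewrite (bigD1 (Ordinal kd)) //= eqxx mulr1 big1 ?addr0 // => i.
  by rewrite -val_eqE eq_sym => /negPf /= ->; rewrite mulr0.
rewrite Td // mulr0 big1 // => i _.
by case: eqP => [ki|_]; [have := ltn_ord i; lia|rewrite mulr0].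
Qed.

End FiniteRank.

Section NonpositivePart.
Variables (K : fieldType) (charK0 : [pchar K] =i pred0).
Variables (n : nat) (c : seq {poly K}).
Implicit Types (f : {poly K}).

Lemma ncoef_aprime f j : ncoef (aprime n c f) j =
  \sum_(n <= i < size c) (c`_i).[j.+1%:R] * ncoef f (i - n + j).
Proof.
rewrite /aprime ncoef_sum; apply: eq_bigr => i _.
by rewrite ncoef_polH ncoef_iter_deltaX.
Qed.

Lemma aprime_linear : linear (aprime n c).
Proof.
move=> k f g; apply: (ncoef_inj charK0) => j.
rewrite ncoefD ncoefZ !ncoef_aprime mulr_sumr -big_split /=.
by apply: eq_bigr => i _; rewrite ncoefD ncoefZ; ring.
Qed.

Definition nonpos_part f := aprime n c (iter n (@deltaX K) f).

Lemma ncoef_nonpos_part f j : ncoef (nonpos_part f) j =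
  \sum_(n <= i < size c) (c`_i).[j.+1%:R] * ncoef f (i + j).
Proof.
rewrite /nonpos_part ncoef_aprime big_nat [RHS]big_nat.
apply: eq_bigr => i /andP[ni _].
by rewrite ncoef_iter_deltaX addnA subnKC.
Qed.

Lemma nonpos_part_linear : linear nonpos_part.
Proof.
move=> k f g; rewrite /nonpos_part -aprime_linear; congr aprime.
by apply: (ncoef_inj charK0) => j; rewrite ncoefD ncoefZ !ncoef_iter_deltaX ncoefD ncoefZ.
Qed.

Lemma nonpos_part_lowers k f : (size f <= k + n)%N -> (size (nonpos_part f) <= k)%N.
Proof.
move=> fk; apply/leq_sizeP => j kj; apply/eqP; rewrite -(ncoef_eq0 charK0).
rewrite ncoef_nonpos_part big_nat big1 // => i /andP[ni _].
have fij : (size f <= i + j)%N by apply: leq_trans fk _; lia.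
by rewrite /ncoef (nth_default _ fij) mul0r mulr0.
Qed.

(** Only the term [a_{-n} \partial^n] reaches degree [k] from [x^(k + n)], and H
    multiplies [x^k] by [k + 1].  *)
Lemma nonpos_part_diag k : c`_n != 0 ->
  ((nonpos_part 'X^(k + n))`_k == 0) = root c`_n k.+1%:R.
Proof.
move=> cn; have nc : (n < size c)%N.
  by rewrite ltnNge; apply: contraNN cn => ?; rewrite nth_default.
rewrite -(ncoef_eq0 charK0) ncoef_nonpos_part big_ltn //.
rewrite big_nat big1 => [|i /andP[ni _]].
  by rewrite addr0 addnC /ncoef coefXn eqxx mul1r mulf_eq0 (negPf (fact_neq0 _ _)) // orbF.
by rewrite /ncoef coefXn (_ : (_ == _) = false) ?mul0r ?mulr0 //; lia.
Qed.

End NonpositivePart.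

(** * Surjective elements have no positive part *)

Section NormalForm.
Variables (K : fieldType) (charK0 : [pchar K] =i pred0).
Variables (a : {linear {poly K} -> {poly K}}).
Implicit Types (f h : {poly K}).

Lemma finite_rank_not_surjective (T : {linear {poly K} -> {poly K}}) N :
  (forall k, (N <= k)%N -> T 'X^k = 0) -> (forall h, exists f, T f = h) -> False.
Proof.
move=> TN Tsurj.
have := @surjective_truncation_leq _ T N N.+1; rewrite ltnn => H.
suff : false by []. apply: H => h _; have [f <-] := Tsurj h.
exists (take_poly N f); first exact: size_take_poly.
rewrite [RHS](@linear_coef_expansion _ _ (N + size f)) ?leq_addl //.
rewrite big_split_ord /= [X in _ = _ + X]big1 => [|i _]; last first.
  by rewrite TN ?scaler0 // leq_addr.
rewrite addr0 (@linear_coef_expansion _ _ N) ?size_take_poly //.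
by apply: eq_bigr => i _; rewrite coef_take_poly ltn_ord.
Qed.

(** Let [t] be the degree of [q]. If the top degree [t - m] of the symbol is
    positive, then [a] raises high degrees by exactly [t - m]. For [M] large,
    preimages of polynomials of degree below [M + (t - m)] thus have degree
    below [M], and there are not enough of them. *)
Lemma raising_not_surjective m q N : symbol_of (fun k => a (dpow K k)) m q N ->
  (m < (size q).-1)%N -> (forall h, exists f, a f = h) -> False.
Proof.
move=> [mN aE] mq asurj.
set t := (size q).-1 in mq.
have q0 : lead_coef q != 0.
  by rewrite lead_coef_eq0; apply: contraTneq mq => q00; rewrite /t q00 size_poly0.
have qt : size q = t.+1 by rewrite /t; lia.
have [N2 qN] := eventually_nonroot charK0 q0.
(* The symbol says nothing about x^k for k < N, so M must exceed the degrees of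
   their images; it must also exceed the roots of the leading coefficient. *)
pose B := \max_(k < N) size (a 'X^k).
pose M := maxn (maxn N N2) B.
have raise k f : (M <= k)%N -> (size f <= k)%N -> (size (a f) <= k + (t - m))%N.
  move=> Mk fk; rewrite (linear_coef_expansion _ fk).
  apply: size_sum_leq => i _; apply: leq_trans (size_scale_leq _ _) _.
  have [iN|Ni] := ltnP i N.
    have := leq_bigmax (F := fun k : 'I_N => size (a 'X^k)) (Ordinal iN).
    by move=> /= H; apply: leq_trans H _; rewrite -/B; lia.
  apply/leq_sizeP => j kj; apply/eqP; rewrite -(ncoef_eq0 charK0).
  rewrite (dpowE charK0) linearZ ncoefZ aE //.
  have ik := ltn_ord i; case: ifP => // _; last by rewrite mulr0.
  by rewrite (@nth_default _ _ q) ?horner0 ?mulr0 // qt; lia.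
have := @surjective_truncation_leq _ a M (M + (t - m)).
suff H : forall h, (size h <= M + (t - m))%N ->
    exists2 f : {poly K}, (size f <= M)%N & a f = h by move/(_ H); lia.
move=> h hM; have [f af] := asurj h; exists f => //.
rewrite leqNgt; apply/negP => Mf.
have [p fp] : exists p, size f = p.+1 by exists (size f).-1; lia.
have Mp : (M <= p)%N by lia.
have : (a f)`_(p + (t - m)) = f`_p * (a 'X^p)`_(p + (t - m)).
  apply: linear_top_coef => [|g gp]; first by rewrite fp.
  by rewrite nth_default // raise.
move/eqP.
rewrite af (nth_default _ (leq_trans hM _)) ?leq_add2r // eq_sym mulf_eq0.
have -> : f`_p = lead_coef f by rewrite lead_coefE fp.
rewrite lead_coef_eq0 -size_poly_eq0 fp /= -(ncoef_eq0 charK0).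
rewrite (dpowE charK0) linearZ ncoefZ mulf_eq0 (negPf (fact_neq0 charK0 _)) /=.
rewrite aE ?ifT; [|lia|lia].
have -> : (p + (t - m) + m - p = t)%N by lia.
by rewrite -lead_coefE (negPf (qN _ _)) //; lia.
Qed.

(** The top degree of the symbol is some [- n <= 0]. Its coefficient of degree
    [- i], translated because [a_{-i}] acts after [\partial^i], is the
    polynomial [a_{-i}]; what remains of [a] kills [x^k] for [k] large, so it
    lies in F.  *)
Lemma surjective_nonpos_form : I1 a -> (forall h, exists f, a f = h) ->
  exists n c aF, nonpos_form a n c aF.
Proof.
move=> Ia asurj; have [m [q [N sym_a]]] := I1_has_symbol charK0 Ia.
have [mN aE] := sym_a.
have [q0|q0] := eqVneq q 0.
  exfalso; apply: (finite_rank_not_surjective (N := N) _ asurj) => k Nk.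
  rewrite (dpowE charK0) linearZ /= (symbol_expansion charK0 sym_a Nk).
  by rewrite q0 size_poly0 big_ord0 scaler0.
have [qm|mq] := leqP (size q).-1 m; last first.
  by case: (raising_not_surjective sym_a mq asurj).
have qpos : (0 < size q)%N by rewrite lt0n size_poly_eq0.
have qnm : (size q <= m.+1)%N by lia.
pose n := (m - (size q).-1)%N.
have nE : (size q = (m - n).+1)%N by rewrite /n; lia.
(* On the image of x^k under the i-th derivative, H is k - i + 1, so that k is
   recovered as H + i - 1. *)
pose c := mkseq (fun i => q`_(m - i) \Po ('X + (i%:R - 1)%:P)) m.+1.
have cE i : (i <= m)%N -> c`_i = q`_(m - i) \Po ('X + (i%:R - 1)%:P).
  by move=> im; rewrite nth_mkseq.
have cH i j : (i <= m)%N -> (c`_i).[j.+1%:R] = (q`_(m - i)).[(j + i)%:R].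
  move=> im; rewrite cE // horner_comp hornerD hornerX hornerC -natr1 natrD.
  by congr horner; ring.
have cn : c`_n != 0.
  rewrite cE ?leq_subr // subKn // -lead_coefE comp_poly_eq0 ?lead_coef_eq0 //.
  by rewrite size_XaddC.
pose aF f := a f - nonpos_part n c f.
have linF : linear aF.
  move=> k f g; rewrite /aF linearP (nonpos_part_linear charK0).
  by rewrite scalerBr opprD addrACA.
pose aF' := bundle_linear linF.
exists n, c, aF; split=> //; last first.
  move=> f; rewrite /aF /nonpos_part /aprime.
  rewrite [X in _ - X](_ : _ = \sum_(n <= i < size c) polH c`_i (iter i (@deltaX K) f)).
    by rewrite addrC subrK.
  rewrite big_nat [RHS]big_nat; apply: eq_bigr => i /andP[ni _].
  by rewrite -iterD subnK.
apply: (idealF_finite_rank charK0 (T := aF') (N := N)) => k Nk.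
rewrite (dpowE charK0) linearZ /=; apply/eqP; rewrite scaler_eq0; apply/orP; right.
apply/eqP/(ncoef_inj charK0) => j.
rewrite ncoef0 ncoefB aE // ncoef_nonpos_part; apply/eqP; rewrite subr_eq0; apply/eqP.
under [RHS]eq_bigr => i _ do rewrite ncoef_dpow //.
rewrite size_mkseq.
have [kj|jk] := ltnP k j.
  rewrite ifT; last by lia.
  rewrite (nth_default _ (leq_trans qnm _)) ?horner0; last by lia.
  by rewrite big1 // => i _; case: eqP => [?|_]; [lia|rewrite mulr0].
case: ifP => kjm; last first.
  rewrite big_nat big1 // => i im; case: eqP => [?|_]; [lia|by rewrite mulr0].
have [knj|nkj] := ltnP (k - j) n.
  rewrite (@nth_default _ _ q) ?horner0; last by rewrite nE; lia.
  by rewrite big_nat big1 // => i im; case: eqP => [?|_]; [lia|rewrite mulr0].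
rewrite (bigD1_seq (k - j)%N) ?mem_index_iota ?iota_uniq //=; last by lia.
rewrite subnK // eqxx mulr1 cH; last by lia.
rewrite subnKC // big1 ?addr0 => [|i ik].
  by congr (q`_ _).[_]; lia.
by case: eqP => [?|_]; [lia|rewrite mulr0].
Qed.

End NormalForm.

(** * The surjectivity criterion *)

Section Criterion.
Variables (K : fieldType) (charK0 : [pchar K] =i pred0).
Variables (a : {linear {poly K} -> {poly K}}) (n : nat) (c : seq {poly K}).
Variables (aF : {poly K} -> {poly K}) (D : nat).
Hypotheses (aE : nonpos_form a n c aF) (aFD : in_block D aF).
Implicit Types (f h : {poly K}).

Lemma nonpos_formE f : a f = nonpos_part n c f + aF f.
Proof. exact: (nonpos_form_aprime aE). Qed.

Lemma nonpos_form_high f : (forall j, (j < D)%N -> f`_j = 0) -> a f = nonpos_part n c f.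
Proof. by move=> f0; rewrite nonpos_formE aFD.2 // addr0. Qed.

Lemma nonpos_form_lowers : lowers a n D.
Proof.
move=> k f Dk fk; rewrite nonpos_formE (leq_trans (size_polyD _ _)) //.
by rewrite geq_max nonpos_part_lowers // (leq_trans (aFD.1 f)).
Qed.

Lemma nonpos_form_diag N : (D <= N)%N ->
  diag_neq0 a n N <-> forall j : nat, (N.+1 <= j)%N -> ~~ root c`_n j%:R.
Proof.
case: aE => cn _ _ DN; have E k : (N <= k)%N ->
    ((a 'X^(k + n))`_k != 0) = ~~ root c`_n k.+1%:R.
  move=> Nk; rewrite nonpos_form_high ?nonpos_part_diag // => j jD.
  by rewrite coefXn; case: eqP => // ?; lia.
split=> [H [//|k] Nk|H k Nk]; first by rewrite -E // H.
by rewrite E // H.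
Qed.

Lemma nonpos_form_eventually_diag : exists2 N, (D <= N)%N & diag_neq0 a n N.
Proof.
have [cn _ _] := aE; have [N cN] := eventually_nonroot charK0 cn.
exists (D + N)%N; first exact: leq_addr.
by apply/nonpos_form_diag => [|j Nj]; [exact: leq_addr | apply: cN; lia].
Qed.

Lemma surjective_diag : (forall h, exists f, a f = h) -> diag_neq0 a n D.
Proof.
have [N _ aN] := nonpos_form_eventually_diag.
exact: surjective_diag_neq0 nonpos_form_lowers aN.
Qed.

Lemma surjective_criterion : (forall h, exists f, a f = h) <->
  (forall j : nat, (D.+1 <= j)%N -> ~~ root c`_n j%:R) /\ block_surj a n D.
Proof.
split=> [asurj|[/(nonpos_form_diag (leqnn D)) diag bl]].
  have diag := surjective_diag asurj; split; first exact/nonpos_form_diag.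
  exact: surjective_block nonpos_form_lowers diag asurj.
exact: block_surjective nonpos_form_lowers diag bl.
Qed.

Lemma surjective_dim_ker : (forall h, exists f, a f = h) -> has_dim (ker a) n.
Proof.
move=> asurj; have diag := surjective_diag asurj.
apply: (has_dim_ker_lowering nonpos_form_lowers diag).
exact: surjective_block nonpos_form_lowers diag asurj.
Qed.

End Criterion.

(** * The kernel of a surjective element *)

Section Kernel.
Variables (K : fieldType) (charK0 : [pchar K] =i pred0).
Variables (a : {linear {poly K} -> {poly K}}) (n : nat) (c : seq {poly K}).
Variables (aF : {poly K} -> {poly K}).
Hypothesis (aE : nonpos_form a n c aF).
Implicit Types (f g h : {poly K}).

Lemma lspan_top_monomials d :
  lspan (fun j : 'I_(minn d.+1 n) => 'X^(d - j) : {poly K}) =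
  monom_span (d.+1 - n) d.+1.
Proof.
rewrite monom_spanE; apply/seteqP; split=> f /=.
  move=> [k ->]; split.
    apply: size_sum_leq => j _; rewrite (leq_trans (size_scale_leq _ _)) //.
    by rewrite size_polyXn ltnS leq_subr.
  move=> j jd; rewrite coef_sum big1 // => i _; have := ltn_ord i.
  by rewrite coefZ coefXn; case: eqP => [?|_ _]; [lia|rewrite mulr0].
move=> [fd flow]; exists (fun j => f`_(d - j)); apply/polyP=> l.
rewrite coef_sum; under eq_bigr => j _ do rewrite coefZ coefXn.
have [ln|nl] := ltnP l (d.+1 - n).
  rewrite flow // big1 // => i _; have := ltn_ord i.
  by case: eqP => [?|_ _]; [lia|rewrite mulr0].
have [dl|ld] := ltnP d l.
  rewrite nth_default ?(leq_trans fd) // big1 // => i _.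
  by case: eqP => [?|_]; [lia|rewrite mulr0].
have lt_dl : (d - l < minn d.+1 n)%N by lia.
rewrite (bigD1 (Ordinal lt_dl)) //= subKn // eqxx mulr1 big1 ?addr0 // => i.
rewrite -val_eqE /= => /eqP il; have := ltn_ord i.
by case: eqP => [?|_ _]; [lia|rewrite mulr0].
Qed.

Lemma iter_deltaX_image d :
  iter n (@deltaX K) @` monom_span d.+1 (d + n).+1 = monom_span (d.+1 - n) d.+1.
Proof.
rewrite !monom_spanE; apply/seteqP; split=> f /=.
  move=> [g [gs glow] <-]; split.
    apply/leq_sizeP => j dj; apply/eqP; rewrite -(ncoef_eq0 charK0).
    by rewrite ncoef_iter_deltaX ncoef_eq0 // nth_default // (leq_trans gs); lia.
  move=> j jd; apply/eqP; rewrite -(ncoef_eq0 charK0) ncoef_iter_deltaX.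
  by rewrite ncoef_eq0 // glow //; lia.
move=> [fd flow]; exists (iter n (@intX K) f); last first.
  apply: (ncoef_inj charK0) => j; rewrite ncoef_iter_deltaX ncoef_iter_intX //.
  by rewrite ltnNge leq_addr /= addKn.
split=> [|j jd].
  apply/leq_sizeP => j dj; apply/eqP; rewrite -(ncoef_eq0 charK0).
  rewrite ncoef_iter_intX //; case: ifP => // _.
  by rewrite ncoef_eq0 // nth_default // (leq_trans fd); lia.
apply/eqP; rewrite -(ncoef_eq0 charK0) ncoef_iter_intX //; case: ifP => // jn.
by rewrite ncoef_eq0 // flow //; lia.
Qed.

(** [\partial^n] maps the span of [x^(d+1), ..., x^(d+n)] onto that of the
    monomials [x^(d-j)] with [0 <= j < n] and [j <= d].  *)
Lemma lspan_aprime d :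
  lspan (fun j : 'I_(minn d.+1 n) => aprime n c 'X^(d - j)) =
  nonpos_part n c @` monom_span d.+1 (d + n).+1.
Proof.
transitivity (aprime n c @` (iter n (@deltaX K) @` monom_span d.+1 (d + n).+1)).
  rewrite iter_deltaX_image -lspan_top_monomials.
  pose b' := bundle_linear (aprime_linear charK0 n c).
  have bE (k : 'I_(minn d.+1 n) -> K) :
      \sum_j k j *: aprime n c 'X^(d - j) = aprime n c (\sum_j k j *: 'X^(d - j)).
    by rewrite -[RHS]/(b' _) linear_sum; apply: eq_bigr => j _; rewrite linearZ.
  apply/seteqP; split=> f /=.
    by move=> [k ->]; rewrite bE; eexists; [exists k|].
  by move=> [_ [k ->] <-]; exists k; rewrite bE.
by rewrite image_comp.
Qed.

Lemma ker_injective_aprime : injective (aprime n c) ->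
  (forall f, aF f = 0) -> ker a = monom_span 0 n /\
  ker a = ker (fun f => iter n (@deltaX K) f).
Proof.
move=> binj aF0.
have b0 : aprime n c 0 = 0.
  by apply: (ncoef_inj charK0) => j; rewrite ncoef_aprime ncoef0 big1 // => i _;
     rewrite ncoef0 mulr0.
have -> : ker a = ker (fun f => iter n (@deltaX K) f).
  apply/seteqP; split=> f /=; rewrite /ker /= (nonpos_form_aprime aE) aF0 addr0.
    by rewrite -[X in _ = X]b0 => /binj.
  by move=> ->.
split=> //; rewrite monom_spanE; apply/seteqP; split=> f /=.
  move=> f0; split=> //; apply/leq_sizeP => j nj; apply/eqP.
  by rewrite -(ncoef_eq0 charK0) -(subnKC nj) -ncoef_iter_deltaX f0 ncoef0.
move=> [fn _]; apply: (ncoef_inj charK0) => j; apply/eqP.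
by rewrite ncoef_iter_deltaX ncoef0 ncoef_eq0 // nth_default // (leq_trans fn) ?leq_addr.
Qed.

Section PositiveDegree.
Variable d : nat.
Hypothesis aFd : in_block d.+1 aF.

Local Notation Kled := (monom_span 0 d.+1 : set {poly K}).
Local Notation M := (monom_span d.+1 (d + n).+1 : set {poly K}).
Local Notation b := (nonpos_part n c).

Lemma KledP f : Kled f <-> (size f <= d.+1)%N.
Proof. by rewrite monom_spanE; split=> [[]|]. Qed.

Lemma a_eq_nonpos_part f : M f -> a f = b f.
Proof. by rewrite monom_spanE => -[_ flow]; exact: nonpos_form_high aFd _ flow. Qed.

Lemma proj_gtM f : (size f <= (d + n).+1)%N -> M (proj_gt d f).
Proof.
rewrite monom_spanE => fs; split=> [|j jd].
  apply/leq_sizeP => j dj; rewrite coefB coef_take_poly !nth_default ?if_same ?subr0 //.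
  exact: leq_trans dj.
by rewrite coefB coef_take_poly jd subrr.
Qed.

Lemma proj_gt_id f : M f -> proj_gt d f = f.
Proof.
rewrite monom_spanE => -[_ flow]; apply/polyP=> j; rewrite coefB coef_take_poly.
by case: ifP => [/flow ->|_]; rewrite subr0.
Qed.

Lemma proj_gt_linear : linear (proj_gt d : {poly K} -> {poly K}).
Proof.
by move=> k f g; rewrite /proj_gt linearP scalerBr opprD addrACA.
Qed.

Lemma proj_gt_eq0 f : proj_gt d f = 0 <-> Kled f.
Proof.
rewrite KledP; split=> [/eqP|fd].
  by rewrite subr_eq0 => /eqP ->; exact: size_take_poly.
by rewrite /proj_gt take_poly_id // subrr.
Qed.

(** Cutting polynomials of degree at most [d + n] at degree [d] splits their
    image under [a] as the sum of [a] on the low part and [a' \partial^n] on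
    the high part, on which [a_F] vanishes.  *)
Lemma block_surj_sumset : block_surj a n d.+1 <->
  sumset (a @` Kled) (lspan (fun j : 'I_(minn d.+1 n) => aprime n c 'X^(d - j))) = Kled.
Proof.
rewrite lspan_aprime.
have sE h : sumset (a @` Kled) (b @` M) h <->
    exists2 f : {poly K}, (size f <= d.+1 + n)%N & a f = h.
  split.
    move=> [_ [f /KledP fd <-]] [_ [g Mg <-]] <-; exists (f + g).
      have [gs _] : (size g <= (d + n).+1)%N /\ forall j, (j < d.+1)%N -> g`_j = 0.
        by move: Mg; rewrite monom_spanE.
      by rewrite (leq_trans (size_polyD _ _)) // geq_max gs (leq_trans fd) // leq_addr.
    by rewrite linearD (a_eq_nonpos_part Mg).
  move=> [f fs <-]; exists (a (take_poly d.+1 f)).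
    by exists (take_poly d.+1 f) => //; apply/KledP; exact: size_take_poly.
  exists (b (proj_gt d f)); first by exists (proj_gt d f) => //; exact: proj_gtM.
  rewrite -(a_eq_nonpos_part (proj_gtM fs)) -linearD; congr (a _).
  by rewrite addrC subrK.
split=> [bl|E h hd].
  apply/seteqP; split=> h; rewrite sE KledP; last exact: bl.
  move=> [f fs <-]; exact: (nonpos_form_lowers charK0 aE aFd).
by apply/sE; rewrite E; apply/KledP.
Qed.

Lemma coset_eq0 h : coset (a @` Kled) h = coset (a @` Kled) 0 <-> (a @` Kled) h.
Proof.
have K0 : Kled 0 by apply/KledP; rewrite size_poly0.
split=> [E|[f /KledP fd <-]].
  have : coset (a @` Kled) h h.
    by exists 0; [exists 0; rewrite ?linear0|rewrite addr0].
  by rewrite E => -[w aw]; rewrite add0r => <-.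
apply/seteqP; split=> _ [_ [g /KledP gd <-] <-].
  exists (a (f + g)); last by rewrite add0r linearD.
  exists (f + g) => //; apply/KledP.
  by rewrite (leq_trans (size_polyD _ _)) // geq_max fd.
exists (a (g - f)); last by rewrite add0r linearB addrC subrK.
exists (g - f) => //; apply/KledP.
by rewrite (leq_trans (size_polyD _ _)) // size_polyN geq_max gd.
Qed.

Lemma stable_Kled : a @` Kled `<=` Kled /\ b @` M `<=` Kled.
Proof.
have low := nonpos_form_lowers charK0 aE aFd.
split=> _ [f Kf <-]; apply/KledP.
  by apply: low => //; rewrite (leq_trans ((KledP f).1 Kf)) // leq_addr.
by move: Kf; rewrite monom_spanE => -[fs _]; exact: (nonpos_part_lowers charK0).
Qed.

Hypothesis asurj : forall h, exists f, a f = h.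

Local Notation kerdelta :=
  [set f | M f /\ coset (a @` Kled) (b f) = coset (a @` Kled) 0].

Lemma ker_size f : a f = 0 -> (size f <= (d + n).+1)%N.
Proof.
have low := nonpos_form_lowers charK0 aE aFd.
have diag := surjective_diag charK0 aE aFd asurj.
by move=> af; apply: (lowers_preimage low diag); rewrite ?af ?size_poly0.
Qed.

(** An element of the kernel is [v - u] with [v] in the span of
    [x^(d+1), ..., x^(d+n)] and [u] of degree at most [d], and it is killed
    exactly when [a' \partial^n v = a u], which says that [v] is in the kernel
    of [delta].  *)
Lemma proj_gt_ker : proj_gt d @` ker a = kerdelta.
Proof.
apply/seteqP; split=> [_ [f af <-]|v [Mv /coset_eq0 [u Ku auv]]] /=.
  have Mf := proj_gtM (ker_size af); split=> //; apply/coset_eq0.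
  exists (- take_poly d.+1 f).
    by apply/KledP; rewrite size_polyN size_take_poly.
  by rewrite -a_eq_nonpos_part // /proj_gt linearB af sub0r linearN.
exists (v - u); first by rewrite /ker /= linearB auv a_eq_nonpos_part // subrr.
rewrite -[v - u]addrC -scaleN1r proj_gt_linear (proj_gt_eq0 u).2 // scaler0 add0r.
exact: proj_gt_id.
Qed.

Lemma finite_dim_kernels :
  [/\ finite_dim (Kled `&` ker a), finite_dim (ker a) & finite_dim kerdelta].
Proof.
have kera : finite_dim (ker a) by exists n; exact: (surjective_dim_ker charK0 aE aFd).
split=> //.
  have low := nonpos_form_lowers charK0 aE aFd.
  have -> : Kled `&` ker a = [set f : {poly K} | (size f <= d.+1)%N /\ a f = 0].
    by apply/seteqP; split=> f [/KledP].
  eexists; apply: (@has_dim_truncated_ker _ _ _ d.+1) => f fd.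
  by apply: low; rewrite // (leq_trans fd) // leq_addr.
rewrite -proj_gt_ker.
pose p := bundle_linear proj_gt_linear.
exact: (@finite_dim_image _ p).
Qed.

Lemma ker_exact : short_exact (Kled `&` ker a) (ker a) kerdelta id (proj_gt d).
Proof.
split=> //.
- by move=> k f g _ _; exact: proj_gt_linear.
- rewrite image_id setIC; congr (_ `&` _).
  by apply/seteqP; split=> f /proj_gt_eq0.
- exact: proj_gt_ker.
Qed.

(** The [v_i - u_i] lift to the kernel of [a] the basis [v_i] of its image under
    the projection, and so span a complement of the kernel of that
    projection.  *)
Lemma ker_complement s (v u : 'I_s -> {poly K}) :
  is_basis v kerdelta -> (forall i, Kled (u i)) ->
  (forall i, b (v i) = a (u i)) ->
  direct_lines (fun i => v i - u i) /\
  is_dsum (Kled `&` ker a) (lspan (fun i => v i - u i)) (ker a).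
Proof.
move=> [vfree vspan] Ku buv.
pose p := bundle_linear proj_gt_linear.
have Mv i : M (v i).
  have : kerdelta (v i); last by case.
  rewrite -vspan; exists (fun j => (j == i)%:R).
  rewrite (bigD1 i) //= eqxx scale1r big1 ?addr0 // => j /negPf ->.
  by rewrite scale0r.
have pE (k : 'I_s -> K) : p (\sum_i k i *: (v i - u i)) = \sum_i k i *: v i.
  rewrite linear_sum; apply: eq_bigr => i _; rewrite linearZ linearB /=.
  by rewrite proj_gt_id // (proj_gt_eq0 (u i)).2 // subr0.
have kerE (k : 'I_s -> K) : a (\sum_i k i *: (v i - u i)) = 0.
  rewrite linear_sum big1 // => i _; rewrite linearZ linearB /=.
  by rewrite a_eq_nonpos_part // buv subrr scaler0.
split=> [k k0 i|].
  by rewrite (vfree k) ?scale0r // -pE k0 linear0.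
split; last first.
  apply/seteqP; split=> f /=.
    move=> [[/proj_gt_eq0 pf _] [k fE]]; move: pf; rewrite -[proj_gt _ _]/(p f) fE pE.
    by move=> /vfree k0; rewrite big1 // => i _; rewrite k0 scale0r.
  move=> ->; split; last first.
    by exists (fun=> 0); rewrite big1 // => i _; rewrite scale0r.
  by split; [apply/KledP; rewrite size_poly0|rewrite /ker /= linear0].
apply/seteqP; split=> f /=.
  move=> [g [_ ag]] [_ [k ->]] <-.
  by rewrite /ker /= linearD kerE ag addr0.
move=> af; have : kerdelta (proj_gt d f) by rewrite -proj_gt_ker; exists f.
rewrite -vspan => -[k kE].
exists (f - \sum_i k i *: (v i - u i)).
  split; last by rewrite /ker /= linearB kerE af subrr.
  by apply/proj_gt_eq0; rewrite -[LHS]/(p _) linearB pE /= kE subrr.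
by exists (\sum_i k i *: (v i - u i)); [exists k|rewrite subrK].
Qed.

End PositiveDegree.
End Kernel.

(** * The two cases of the theorem *)

Section Assembly.
Variables (K : fieldType) (charK0 : [pchar K] =i pred0).
Implicit Types (f g h : {poly K}) (c : seq {poly K}).
Implicit Types (aF : {poly K} -> {poly K}).

Lemma set_surjT (g : {poly K} -> {poly K}) :
  set_surj [set: {poly K}] [set: {poly K}] g <-> forall h, exists f, g f = h.
Proof.
by split=> gs h; [have [|f _ <-] := gs h; [|exists f]|move=> _; have [f] := gs h; exists f].
Qed.

Lemma in_block0 aF : (forall f, aF f = 0) -> in_block 0 aF.
Proof. by move=> aF0; split=> f *; rewrite aF0 ?size_poly0. Qed.

Lemma in_block_degF aF : idealF aF -> in_block (degF aF).+1 aF.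
Proof. by move=> /degFP[] /(Fle_in_block charK0). Qed.

(** [a'] is itself of the form covered by the criterion, with [n = 0] and no part
    in F; being triangular, it is then injective as well.  *)
Lemma aprime_bijective n c : c`_n != 0 ->
  (forall j : nat, (0 < j)%N -> ~~ root c`_n j%:R) ->
  set_bij [set: {poly K}] [set: {poly K}] (aprime n c).
Proof.
move=> cn croot.
pose b := bundle_linear (aprime_linear charK0 n c).
pose z : {poly K} -> {poly K} := fun=> 0.
have bE : nonpos_form b 0 (drop n c) z.
  split=> [||f].
  - by rewrite nth_drop addn0.
  - exists 0%N => //; exists (fun _ _ => 0) => f.
    by rewrite !big_ord1 scale0r.
  - rewrite addr0 /= /aprime size_drop -{1}[n]add0n big_addn.
    by apply: eq_bigr => i _; rewrite nth_drop addnC addKn.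
have zD : in_block 0 z by exact: in_block0.
have bsurj : forall h, exists f, b f = h.
  apply/(surjective_criterion charK0 bE zD); split=> [j j0|h].
    by rewrite nth_drop addn0 croot.
  by rewrite leqn0 size_poly_eq0 => /eqP ->; exists 0; rewrite ?size_poly0 ?linear0.
split=> //; last by apply/set_surjT.
move=> f g _ _ bfg; apply/eqP; rewrite -subr_eq0 -size_poly_eq0 -leqn0.
have low := nonpos_form_lowers charK0 bE zD.
have diag := surjective_diag charK0 bE zD bsurj.
apply: (lowers_preimage low diag) => //.
by rewrite linearB /= bfg subrr size_poly0.
Qed.

Lemma idealF_not_surjective (g : {poly K} -> {poly K}) :
  idealF g -> ~ forall h, exists f, g f = h.
Proof.
move=> [d _ /(Fle_in_block charK0)[gd _]] gs.
have [f gf] := gs 'X^(d.+1); have := gd f.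
by rewrite gf size_polyXn ltnn.
Qed.

End Assembly.

Theorem theorem6p3 (K : fieldType) (charK0 : [pchar K] =i pred0)
    (a : {poly K} -> {poly K}) (Ia : I1 a) :
  (set_surj [set: {poly K}] [set: {poly K}] a <->
   exists (n : nat) (c : seq {poly K}) (aF : {poly K} -> {poly K}),
     [/\ nonpos_form a n c aF,
         ((forall f, aF f = 0) ->
            forall j : nat, (1 <= j)%N -> ~~ root c`_n j%:R) &
         (~ (forall f, aF f = 0) ->
            let d := degF aF in
            (forall j : nat, (d + 2 <= j)%N -> ~~ root c`_n j%:R) /\
            sumset (a @` monom_span 0 d.+1)
                   (lspan (fun j : 'I_(minn d.+1 n) => aprime n c 'X^(d - j)))
            = monom_span 0 d.+1)])
  /\
  (set_surj [set: {poly K}] [set: {poly K}] a ->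
   forall (n : nat) (c : seq {poly K}) (aF : {poly K} -> {poly K}),
     nonpos_form a n c aF ->
     [/\ ((forall f, aF f = 0) ->
            [/\ set_bij [set: {poly K}] [set: {poly K}] (aprime n c),
                ker a = ker (fun f : {poly K} => iter n (@deltaX K) f) &
                ker a = monom_span 0 n]),
         (~ (forall f, aF f = 0) ->
            let d := degF aF in
            let Kled := monom_span 0 d.+1 in
            let M := monom_span d.+1 (d + n).+1 in
            let b := fun f : {poly K} => aprime n c (iter n (@deltaX K) f) in
            let delta := fun f : {poly K} => coset (a @` Kled) (b f) in
            let kerdelta := [set f | M f /\ delta f = coset (a @` Kled) 0] in
            [/\ a @` Kled `<=` Kled /\ b @` M `<=` Kled,
                [/\ finite_dim (Kled `&` ker a), finite_dim (ker a) &
                    finite_dim kerdelta],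
                short_exact (Kled `&` ker a) (ker a) kerdelta
                  id (proj_gt d) &
                forall (s : nat) (v u : 'I_s -> {poly K}),
                  is_basis v kerdelta ->
                  (forall i, Kled (u i)) ->
                  (forall i, b (v i) = a (u i)) ->
                  direct_lines (fun i => v i - u i) /\
                  is_dsum (Kled `&` ker a) (lspan (fun i => v i - u i)) (ker a)]) &
         has_ind a n%:Z /\ has_dim (ker a) n]).
Proof.
have [a0 aE0] : exists a0 : {linear {poly K} -> {poly K}}, a = a0.
  by exists (bundle_linear (I1_linear Ia)).
rewrite {}aE0 in Ia *; rewrite set_surjT.
split.
  split=> [asurj|[n [c [aF [aE aF0 aFd]]]]].
    have [n [c [aF aE]]] := surjective_nonpos_form charK0 Ia asurj.
    exists n, c, aF; split=> // [aF0|_].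
      by have [] := (surjective_criterion charK0 aE (in_block0 aF0)).1 asurj.
    have [_ /(in_block_degF charK0) FaF _] := aE.
    have [croot bl] := (surjective_criterion charK0 aE FaF).1 asurj.
    split=> [j|]; first by rewrite addn2; exact: croot.
    exact/(block_surj_sumset charK0 aE FaF).
  have [z|nz] := pselect (forall f, aF f = 0).
    apply/(surjective_criterion charK0 aE (in_block0 z)).
    split=> [|h]; first exact: aF0.
    rewrite leqn0 size_poly_eq0 => /eqP ->.
    by exists 0; rewrite ?size_poly0 ?linear0.
  have [_ /(in_block_degF charK0) FaF _] := aE.
  apply/(surjective_criterion charK0 aE FaF).
  have [croot sumE] := aFd nz; split=> [j|]; first by rewrite -addn2; exact: croot.
  exact/(block_surj_sumset charK0 aE FaF).
move=> asurj n c aF aE; have [cn /(in_block_degF charK0) FaF _] := aE; split.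
- move=> z; have [croot _] := (surjective_criterion charK0 aE (in_block0 z)).1 asurj.
  have bij := aprime_bijective charK0 cn croot.
  have binj : injective (aprime n c).
    by move=> f g; apply: (set_bij_inj bij); rewrite inE.
  by have [] := ker_injective_aprime charK0 aE binj z.
- move=> _ d Kled M b delta kerdelta; split.
  + exact: (stable_Kled charK0 aE FaF).
  + exact: (finite_dim_kernels charK0 aE FaF asurj).
  + exact: (ker_exact charK0 aE FaF asurj).
  + exact: (ker_complement charK0 aE FaF asurj).
have dimker := surjective_dim_ker charK0 aE FaF asurj.
split=> //; split; first by move/(idealF_not_surjective charK0); apply.
exists n, 0%N; split=> //; last by rewrite subr0.
(* The cokernel vanishes: every coset of the range is the range itself. *)
exists (fun=> 0); split=> [k _ []//|f]; exists (fun=> 0); rewrite big_ord0.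
have -> : range a0 = setT.
  by apply/seteqP; split=> // h _; have [g <-] := asurj h; exists g.
apply/seteqP; split=> x _.
  by exists x; rewrite ?add0r.
by exists (x - f); rewrite // addrC subrK.
Qed.
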